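(* Let $R$ be a reduced extended affine root system and let $\widehat{\mathcal W}$ be the group defined by generators $\widehat w_\alpha$, $\alpha\in R^\times$, and relations $\widehat w_\alpha^2=1$ ($\alpha\in R^\times$) and $\widehat w_\alpha\widehat w_\beta\widehat w_\alpha=\widehat w_{w_\alpha(\beta)}$ ($\alpha,\beta\in R^\times$). Then for any reflectable base $P$ for $R$, the set $\{\widehat w_\alpha\mid\alpha\in P\}$ is a minimal generating set for $\widehat{\mathcal W}$ (it generates $\widehat{\mathcal W}$ and no proper subset of it does).
   Context: All vector spaces are finite-dimensional and real. Let $\mathcal V$ be a vector space with a positive semidefinite symmetric bilinear form $(\cdot,\cdot)$ with radical $\mathcal V^0$. For $R\subseteq\mathcal V$ put $R^0=R\cap\mathcal V^0$, $R^\times=R\setminus R^0$. For $(\alpha,\alpha)\ne0$ put $\alpha^\vee=2\alpha/(\alpha,\alpha)$, $w_\alpha(\beta)=\beta-(\beta,\alpha^\vee)\alpha$. $\langle A\rangle$ is the additive subgroup generated by $A$. $P\subseteq\mathcal V\setminus\mathcal V^0$ is connected if it is not a disjoint union of nonempty $P_1,P_2$ with $(P_1,P_2)=\{0\}$. $R$ is an extended affine root system if: $\langle R\rangle$ is a full lattice in $\mathcal V$; $(\beta,\alpha^\vee)\in\mathbb Z$ for $\alpha,\beta\in R^\times$; $w_\alpha(\beta)\in R$ for $\alpha\in R^\times,\beta\in R$; $R^0=\mathcal V^0\cap(R^\times-R^\times)$; $\alpha\in R^\times\Rightarrow2\alpha\notin R$; $R^\times$ is connected. In particular $R^\times\ne\emptyset$.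 The image $\bar R$ of $R$ in $\mathcal V/\mathcal V^0$ is an irreducible finite root system (containing $0$); $R$ is reduced if $\bar R$ is. For $P\subseteq R^\times$, $\mathcal W_P$ is the group generated by the reflections $w_\alpha$, $\alpha\in P$. $P$ is a reflectable base if $\mathcal W_PP=R^\times$ and no proper subset $P'$ of $P$ satisfies $\mathcal W_{P'}P'=R^\times$. *)

(* Defs.v *)
From HB Require Import structures.
From mathcomp Require Import all_boot all_order all_algebra.
From mathcomp Require Import all_classical reals.

Set Implicit Arguments.
Unset Strict Implicit.
Unset Printing Implicit Defensive.

Import Order.TTheory GRing.Theory Num.Theory.

Local Open Scope classical_set_scope.
Local Open Scope ring_scope.

(** ** Group presentations *)

(* The letter (x, false) stands for the generator x, (x, true) for its formal
   inverse. *)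
Notation word X := (seq (X * bool)).

Section Presentation.
Variables (X : choiceType) (rels : word X -> word X -> Prop).

(* The smallest congruence on words that contains [rels] and the free
   cancellations. *)
Inductive pres_eq : word X -> word X -> Prop :=
| pres_refl u : pres_eq u u
| pres_sym u v : pres_eq u v -> pres_eq v u
| pres_trans u v w : pres_eq u v -> pres_eq v w -> pres_eq u w
| pres_cat u u' v v' :
    pres_eq u u' -> pres_eq v v' -> pres_eq (u ++ v) (u' ++ v')
| pres_cancel x b : pres_eq [:: (x, b); (x, ~~ b)] [::]
| pres_rel u v : rels u v -> pres_eq u v.

Definition pres_eqb : rel (word X) := fun u v => `[< pres_eq u v >].

Lemma pres_eqb_refl : reflexive pres_eqb.
Proof. by move=> u; apply/asboolP/pres_refl. Qed.

Lemma pres_eqb_sym : symmetric pres_eqb.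
Proof. by move=> u v; apply/asboolP/asboolP; apply: pres_sym. Qed.

Lemma pres_eqb_trans : transitive pres_eqb.
Proof.
by move=> v u w /asboolP uv /asboolP vw; apply/asboolP/(pres_trans uv vw).
Qed.

Canonical pres_equiv :=
  EquivRel pres_eqb pres_eqb_refl pres_eqb_sym pres_eqb_trans.

Definition presented_group := {eq_quot pres_equiv}%qT.
HB.instance Definition _ := Choice.on presented_group.

Definition word_class (u : word X) : presented_group :=
  \pi_presented_group%qT u.

Definition word_inv (u : word X) : word X := rev [seq (p.1, ~~ p.2) | p <- u].

Definition pres_one : presented_group := word_class [::].
Definition pres_mul (g h : presented_group) : presented_group :=
  word_class (repr g ++ repr h).
Definition pres_inv (g : presented_group) : presented_group :=
  word_class (word_inv (repr g)).

Lemma word_classP u v : word_class u = word_class v <-> pres_eq u v.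
Proof.
split=> [/eqP|uv]; first by rewrite /word_class piE => /asboolP.
by apply/eqP; rewrite /word_class piE; apply/asboolP.
Qed.

Lemma repr_word_class u : pres_eq (repr (word_class u)) u.
Proof. by apply/word_classP; rewrite /word_class reprK. Qed.

Lemma word_class_repr g : word_class (repr g) = g.
Proof. by rewrite /word_class reprK. Qed.

Lemma pres_mulE u v :
  pres_mul (word_class u) (word_class v) = word_class (u ++ v).
Proof. by apply/word_classP/pres_cat; apply: repr_word_class. Qed.

Lemma word_inv_cons p u : word_inv (p :: u) = word_inv u ++ [:: (p.1, ~~ p.2)].
Proof. by rewrite /word_inv /= rev_cons cats1. Qed.

Lemma pres_mulw_inv u : pres_eq (u ++ word_inv u) [::].
Proof.
elim: u => [|[x b] u IHu]; first exact: pres_refl.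
rewrite word_inv_cons -cat1s -!catA [u ++ _]catA.
apply: pres_trans (pres_cancel x b); rewrite -[[:: (x, b); _]]cat1s.
apply: pres_cat (pres_refl _) _; rewrite -[X in pres_eq _ X]cat0s.
exact: pres_cat IHu (pres_refl _).
Qed.

Lemma word_invK : involutive word_inv.
Proof.
move=> u; rewrite /word_inv map_rev revK -map_comp -[RHS]map_id.
by apply: eq_map => -[x b] /=; rewrite negbK.
Qed.

Lemma pres_inv_mulw u : pres_eq (word_inv u ++ u) [::].
Proof. by rewrite -{2}(word_invK u); apply: pres_mulw_inv. Qed.

Lemma pres_mulA : associative pres_mul.
Proof.
move=> g h k; rewrite -(word_class_repr g) -(word_class_repr h).
by rewrite -(word_class_repr k) !pres_mulE catA.
Qed.

Lemma pres_mul1 : left_id pres_one pres_mul.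
Proof. by move=> g; rewrite -(word_class_repr g) pres_mulE. Qed.

Lemma pres_mulr1 : right_id pres_one pres_mul.
Proof. by move=> g; rewrite -(word_class_repr g) pres_mulE cats0. Qed.

Lemma pres_mulV : left_inverse pres_one pres_inv pres_mul.
Proof.
move=> g; rewrite -{2}(word_class_repr g) pres_mulE.
exact/word_classP/pres_inv_mulw.
Qed.

Lemma pres_mulrV : right_inverse pres_one pres_inv pres_mul.
Proof.
move=> g; rewrite -{1}(word_class_repr g) pres_mulE.
exact/word_classP/pres_mulw_inv.
Qed.

HB.instance Definition _ :=
  isGroup.Build presented_group pres_mulA pres_mul1 pres_mulr1 pres_mulV
    pres_mulrV.

Definition pres_gen (x : X) : presented_group := word_class [:: (x, false)].

Lemma word_class_cat u v :
  word_class (u ++ v) = (word_class u * word_class v)%g.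
Proof. by rewrite -pres_mulE. Qed.

Section Lift.
Variables (G : groupType) (f : X -> G).

Definition word_eval (u : word X) : G :=
  (\prod_(p <- u) (if p.2 then (f p.1)^-1 else f p.1))%g.

Hypothesis f_rels : forall u v, rels u v -> word_eval u = word_eval v.

Lemma word_eval_eq u v : pres_eq u v -> word_eval u = word_eval v.
Proof.
elim=> {u v} // [u v w _ -> _ -> //|u u' v v' _ eu _ ev|x b].
  by rewrite /word_eval !big_cat /= -!/(word_eval _) eu ev.
rewrite /word_eval !big_cons big_nil /= mulg1.
by case: b; rewrite (mulVg, mulgV).
Qed.

(* The universal property of the presentation. *)
Lemma presented_group_lift :
  exists! F : presented_group -> G,
    {morph F : g h / (g * h)%g} /\ (forall x, F (pres_gen x) = f x).
Proof.
pose F (g : presented_group) := word_eval (repr g).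
have FE u : F (word_class u) = word_eval u.
  exact/word_eval_eq/repr_word_class.
exists F; split; first split=> [g h|x].
- rewrite -(word_class_repr g) -(word_class_repr h) -word_class_cat !FE.
  by rewrite /word_eval big_cat.
- by rewrite FE /word_eval big_seq1.
move=> F' [F'M F'g]; apply/funext => g.
have F'1 : F' 1%g = 1%g by apply: (mulgI (F' 1%g)); rewrite -F'M !mulg1.
rewrite -(word_class_repr g) FE; elim: (repr g) => [|[x b] u IHu].
  by rewrite /word_eval big_nil -[word_class _]/(1%g : presented_group) F'1.
rewrite -cat1s word_class_cat F'M -IHu /word_eval cat1s big_cons /=.
congr (_ * _)%g; case: b => //=; last by rewrite F'g.
apply: (mulgI (f x)); rewrite mulgV -{1}F'g -F'M -word_class_cat /=.
by have /word_classP-> := pres_cancel x false; rewrite -F'1.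
Qed.

End Lift.
End Presentation.

(** ** Generating sets *)

Definition generates (G : groupType) (A : set G) : Prop :=
  smallest (fun H : set G => group_closed (mem H)) A = setT.

Definition minimal_generating_set (G : groupType) (A : set G) : Prop :=
  generates A /\ forall B : set G, B `<` A -> ~ generates B.

(** ** Semidefinite forms and reflections *)

Section Ears.
Variables (K : realType) (V : vectType K) (form : {symmetric V}).
Implicit Types (R P A : set V) (a b : V).

Definition positive_semidefinite : Prop := forall v : V, 0 <= form v v.

Definition radical : {vspace V} := orthov form fullv.

Definition coroot a : V := (2 / form a a) *: a.
Definition refl a b : V := b - form b (coroot a) *: a.

(* R^0 and R^x *)
Definition isotropic R : set V := R `&` [set` radical].
Definition nonisotropic R : set V := R `\` isotropic R.

Definition zspan A : set V :=
  smallest (fun L : set V => zmod_closed (mem L)) A.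

Definition full_lattice (L : set V) : Prop :=
  exists e : (\dim {: V}).-tuple V, basis_of fullv e /\
    L = [set \sum_(i < \dim {: V}) e`_i *~ c i
          | c in [set: 'I_(\dim {: V}) -> int]].

Definition connected P : Prop :=
  ~ exists P1 P2 : set V,
    [/\ P1 !=set0, P2 !=set0, P1 `&` P2 = set0, P1 `|` P2 = P
      & forall a b, P1 a -> P2 b -> form a b = 0].

Record extended_affine_root_system R : Prop := ExtendedAffineRootSystem {
  ears_lattice : full_lattice (zspan R);
  ears_int a b : nonisotropic R a -> nonisotropic R b ->
    form b (coroot a) \is a Num.int;
  ears_refl a b : nonisotropic R a -> R b -> R (refl a b);
  ears_isotropic : isotropic R =
    [set` radical] `&`
    [set a - b | a in nonisotropic R & b in nonisotropic R];
  ears_double a : nonisotropic R a -> ~ R (2 *: a);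
  ears_nonempty : nonisotropic R !=set0;
  ears_connected : connected (nonisotropic R)
}.

(* V / V^0, as a zmodType only; the scalar multiple by c of the class of v is
   the class of c *: v. *)
Definition rad_quot := Quotient.quot (pred_of_vspace radical : zmodClosed V).
Definition rad_proj (v : V) : rad_quot := \pi_rad_quot%qT v.

(* Rbar contains 0, which does not count as a root here: the only multiples of a
   nonzero element of Rbar that are nonzero elements of Rbar are itself and its
   opposite. *)
Definition reduced R : Prop :=
  let Rbar := rad_proj @` R in
  forall (v : V) (c : K),
    Rbar (rad_proj v) -> rad_proj v <> 0 ->
    Rbar (rad_proj (c *: v)) -> rad_proj (c *: v) <> 0 ->
    c = 1 \/ c = -1.

(** ** Reflection groups and reflectable bases *)

Definition transformation_group (H : set (V -> V)) : Prop :=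
  [/\ H id, (forall f g, H f -> H g -> H (f \o g))
    & (forall f, H f -> exists g, [/\ H g, cancel f g & cancel g f])].

(* W_P, as a group of transformations of V *)
Definition weyl_group P : set (V -> V) :=
  smallest transformation_group (refl @` P).

Definition weyl_orbit P : set V := [set w a | w in weyl_group P & a in P].

Definition reflectable_base R P : Prop :=
  [/\ P `<=` nonisotropic R, weyl_orbit P = nonisotropic R
    & forall P' : set V, P' `<` P -> weyl_orbit P' <> nonisotropic R].

(** ** The presented group *)

Definition gen_word (X : Type) (s : seq X) : word X :=
  [seq (x, false) | x <- s].

(* In the second family [c] is the root w_a(b), as an element of the subtype
   R^x. *)
Inductive hatW_rels R :
    word (nonisotropic R) -> word (nonisotropic R) -> Prop :=
| hatW_sqr (a : nonisotropic R) : hatW_rels (gen_word [:: a; a]) [::]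
| hatW_conj (a b c : nonisotropic R) : val c = refl (val a) (val b) ->
    hatW_rels (gen_word [:: a; b; a]) (gen_word [:: c]).

Definition hatW R := presented_group (@hatW_rels R).

Definition hat_refl R (a : nonisotropic R) : hatW R := pres_gen _ a.

End Ears.

(* Main.v *)
Require Import Defs.
From mathcomp Require Import all_boot all_order all_algebra.
From mathcomp Require Import all_classical reals.
From mathcomp Require Import ring.

(** Generation is immediate: a root is [w p] with [w] a product of reflections
    in elements of [P] and [p] in [P], and the conjugation relations write its
    generator as the corresponding conjugate of the generator of [p]
    ([hat_refl_generates]).

    For minimality, suppose that the generators indexed by a proper subset
    [P'] of [P] generate the presented group. Two actions of this group give a
    contradiction.

    - It acts on [V] by reflections ([refl_conj] is the relation to check), so
      the reflections in [P'] generate the whole Weyl group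
      ([generates_weyl_group]), and the orbit [N] of [P'] under them is stable
      under every reflection in a root.

    - A map from the roots to signs satisfies the relations as soon as it is
      constant on Weyl orbits: signs square to one and commute. Hence for every
      stable set [N] of roots there is a sign character, acting on a set of two
      elements, that is nontrivial exactly at the generators of the roots
      outside [N] ([generates_sub_stable]).

    The sign character of the orbit [N] of [P'] is trivial on the generators
    indexed by [P'], hence trivial. So no root lies outside [N], which
    contradicts the minimality of the reflectable base. *)

Set Implicit Arguments.
Unset Strict Implicit.
Unset Printing Implicit Defensive.

Import GRing.Theory.

Local Open Scope classical_set_scope.
Local Open Scope ring_scope.

Lemma generates_sub (G : groupType) (A H : set G) :
  generates A -> group_closed (mem H) -> A `<=` H -> forall g, H g.
Proof. by move=> /seteqP[_ genA] HG AH g; apply: (genA g I). Qed.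

(** * Actions of presented groups by involutions *)

Section PresentedAction.
Variables (X : choiceType) (rels : word X -> word X -> Prop).
Variables (T : Type) (f : X -> T -> T).

(** The exponents of the letters are ignored: the action is used for
    involutions [f x] only, where a letter and its inverse act alike. *)
Definition word_act (u : word X) (t : T) : T := foldr (fun p => f p.1) t u.

Definition pres_act (g : presented_group rels) : T -> T := word_act (repr g).

Lemma word_act_cat u v t : word_act (u ++ v) t = word_act u (word_act v t).
Proof. by rewrite /word_act foldr_cat. Qed.

Hypothesis f_inv : forall x, involutive (f x).
Hypothesis f_rels : forall u v, rels u v -> word_act u =1 word_act v.

Lemma word_act_eq u v : pres_eq rels u v -> word_act u =1 word_act v.
Proof.
elim=> {u v} [u|u v _ IH|u v w _ IHu _ IHv|u u' v v' _ IHu _ IHv|x b|u v] t //.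
- by rewrite IHu.
- by rewrite !word_act_cat IHv IHu.
- exact: f_inv.
- exact: f_rels.
Qed.

Lemma pres_act_word u : pres_act (word_class rels u) = word_act u.
Proof. by apply/funext/word_act_eq/repr_word_class. Qed.

Lemma pres_act_gen x : pres_act (pres_gen rels x) = f x.
Proof. by rewrite pres_act_word. Qed.

Lemma pres_actM g h : pres_act (g * h)%g = pres_act g \o pres_act h.
Proof.
apply/funext => t; rewrite -(word_class_repr g) -(word_class_repr h).
by rewrite -word_class_cat !pres_act_word word_act_cat.
Qed.

Lemma pres_act1 : pres_act 1%g = id.
Proof. exact: (pres_act_word [::]). Qed.

(** The group [H] of transformations will be a reflection group in one
    application and the trivial group in the other. *)
Lemma pres_act_generated (A : set (presented_group rels)) (H : set (T -> T)) :
  H id -> (forall u v, H u -> H v -> H (u \o v)) ->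
  (forall u, H u -> exists v, [/\ H v, cancel u v & cancel v u]) ->
  generates A -> (forall g, A g -> H (pres_act g)) -> forall g, H (pres_act g).
Proof.
move=> H1 HM HV genA AH; apply: (generates_sub genA) => //; split=> [|g h].
  by rewrite inE /= pres_act1.
rewrite !inE /= => Hg Hh; rewrite pres_actM; apply: HM => //.
have [v [Hv hv vh]] := HV _ Hh; suff -> : pres_act h^-1%g = v by [].
apply/funext => t; rewrite -{1}(vh t) -[LHS]/((_ \o pres_act h) _).
by rewrite -pres_actM mulVg pres_act1.
Qed.

End PresentedAction.

(** * Reflections *)

Section Reflections.
Variables (K : realType) (V : vectType K) (form : {symmetric V}).
Implicit Types (R P S : set V) (a b v : V).

Local Notation refl := (refl form).

Lemma form_sym a b : form a b = form b a.
Proof. by rewrite hermC expr0 mul1r. Qed.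

Lemma form_coroot b a : form b (coroot form a) = 2 / form a a * form b a.
Proof. by rewrite /coroot linearZr. Qed.

Lemma reflE a b : refl a b = b - (2 / form a a * form b a) *: a.
Proof. by rewrite /Defs.refl form_coroot. Qed.

Lemma reflB a b c : refl a (b - c) = refl a b - refl a c.
Proof. by rewrite !reflE linearBl mulrBr scalerBl opprD addrACA -opprD. Qed.

Lemma reflZ a k b : refl a (k *: b) = k *: refl a b.
Proof. by rewrite !reflE linearZl_LR scalerBr scalerA /= mulrCA. Qed.

(** An isotropic [a] is no exception: its coroot is [0], as [2 / 0 = 0], and
    [refl a] is the identity. *)
Lemma reflK a : involutive (refl a).
Proof.
move=> b; rewrite !reflE.
rewrite linearBl linearZl_LR /= -addrA -opprD -scalerDl.
set k := (X in X *: a); suff -> : k = 0 by rewrite scale0r subr0.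
have [a0|a0] := eqVneq (form a a) 0; first by rewrite /k a0 invr0; ring.
by rewrite /k; field.
Qed.

Lemma form_refl a b c : form (refl a b) (refl a c) = form b c.
Proof.
rewrite !reflE linearBl !linearBr !linearZl_LR !linearZr /= (form_sym a c).
have [->|a0] := eqVneq (form a a) 0; first by rewrite invr0; ring.
by field.
Qed.

(** The conjugation relation of the presentation holds for the actual
    reflections because [refl a] is an isometry. *)
Lemma refl_conj a b v : refl a (refl b (refl a v)) = refl (refl a b) v.
Proof.
rewrite (reflE b) reflB reflZ reflK (reflE (refl a b)) form_refl.
by rewrite -(form_refl a v) ?reflK.
Qed.

(** If [refl a b] were in the radical, it would be orthogonal to [a], hence fixed
    by [refl a]; then [b] itself would be in the radical. *)
Lemma refl_nonisotropic R a b : extended_affine_root_system form R ->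
  nonisotropic form R a -> nonisotropic form R b ->
  nonisotropic form R (refl a b).
Proof.
move=> ears Ra [Rb b_niso]; have Rab := ears_refl ears Ra Rb.
split=> // -[_ /= ab_rad]; apply: b_niso; split=> //=; move: (ab_rad).
have /(_ a (memvf _)) ab0 := mem_orthovP ab_rad.
by rewrite -{2}[b](reflK a) (reflE a (refl a b)) ab0 mulr0 scale0r subr0.
Qed.

Lemma weyl_group1 P : weyl_group form P id.
Proof. by move=> H [[]]. Qed.

Lemma weyl_groupM P u w :
  weyl_group form P u -> weyl_group form P w -> weyl_group form P (u \o w).
Proof.
move=> Pu Pw H HP; have [[_ HM _] _] := HP.
by apply: HM; [apply: Pu|apply: Pw].
Qed.

(** The stabilizer of [S] among the transformations need not be closed under
    inverses, so the induction runs over the bijections that preserve [S] in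
    both directions; a reflection is its own inverse. *)
Lemma weyl_group_stable P S :
  (forall a b, P a -> S b -> S (refl a b)) ->
  forall w b, weyl_group form P w -> S b -> S (w b).
Proof.
move=> PS w b Pw.
pose H := [set u : V -> V | (forall v, S v -> S (u v)) /\
  exists u', [/\ forall v, S v -> S (u' v), cancel u u' & cancel u' u]].
suff [+ _] : H w by apply.
apply: Pw; split=> [|_ [a Pa <-]]; last first.
  split=> [v|]; first exact: PS.
  by exists (refl a); split=> [v||]; [exact: PS|exact: reflK|exact: reflK].
split.
- by split=> //; exists id.
- move=> x y [Sx [x' [Sx' xx' x'x]]] [Sy [y' [Sy' yy' y'y]]].
  split=> [v Sv|]; first exact/Sx/Sy.
  exists (y' \o x').
  by split=> [v Sv||]; [exact/Sy'/Sx'|exact: can_comp|exact: can_comp].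
- move=> x [Sx [x' [Sx' xx' x'x]]].
  by exists x'; split=> //; split=> //; exists x.
Qed.

Lemma weyl_orbit_sub P : P `<=` weyl_orbit form P.
Proof.
by move=> a Pa; exists id; [exact: weyl_group1|exists a].
Qed.

Lemma weyl_orbit_min P S : P `<=` S ->
  (forall a b, P a -> S b -> S (refl a b)) -> weyl_orbit form P `<=` S.
Proof.
by move=> PS S_refl _ [w Pw [a Pa <-]]; apply: weyl_group_stable Pw (PS _ Pa).
Qed.

(** * Generating sets of the presented group *)

Variable R : set V.
Hypothesis R_ears : extended_affine_root_system form R.

Local Notation Rx := (nonisotropic form R).
Local Notation hatW := (hatW form R).

Lemma hat_reflK (a : Rx) : (hat_refl a * hat_refl a)%g = 1%g.
Proof.
by rewrite -word_class_cat; apply/word_classP/pres_rel; exact: hatW_sqr.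
Qed.

Lemma hat_refl_conj (a b c : Rx) : val c = refl (val a) (val b) ->
  (hat_refl a * hat_refl b * hat_refl a)%g = hat_refl c.
Proof.
move=> cE.
rewrite -(word_class_cat _ [:: _] [:: _]) -(word_class_cat _ _ [:: _]).
apply/word_classP/pres_rel; exact: (hatW_conj cE).
Qed.

Lemma hat_refl_generates P : P `<=` Rx -> weyl_orbit form P = Rx ->
  generates [set hat_refl a | a in [set a : Rx | P (val a)]].
Proof.
move=> PR orbP; apply/seteqP; split=> // g _ H [[H1 HV] PH].
have HG : group_closed (mem H) by [].
have HM := group_closedM HG.
pose S := [set v | exists2 a : Rx, val a = v & H (hat_refl a)].
have PS : P `<=` S.
  move=> a Pa; pose a' : Rx := SigSub (mem_set (PR _ Pa)).
  by exists a' => //; apply: PH; exists a'.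
have RS : Rx `<=` S.
  rewrite -orbP; apply: weyl_orbit_min => // _ _ /PS[a <- Ha] [b <- Hb].
  have Rc := refl_nonisotropic R_ears (set_valP a) (set_valP b).
  exists (SigSub (mem_set Rc)) => //; rewrite -(@hat_refl_conj a b) //.
  by apply/set_mem/HM; [apply: HM|]; apply/mem_set.
have genH (a : Rx) : H (hat_refl a).
  by have [b /val_inj <-] := RS _ (set_valP a).
rewrite -(word_class_repr g); elim: (repr g) => [|[x b] u IHu].
  exact/set_mem.
rewrite -cat1s word_class_cat; apply/set_mem/HM; apply/mem_set => //.
case: b; last exact: genH.
(* The generators are involutions, so the inverse letters are covered too. *)
suff -> : word_class (@hatW_rels _ _ form R) [:: (x, true)] = hat_refl x.
  exact: genH.
apply: (mulIg (hat_refl x)); rewrite hat_reflK -word_class_cat.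
by apply/word_classP/(pres_cancel _ x true).
Qed.

(** The action of the presented group on [V] by reflections sends a generating
    set into [weyl_group form P], hence the whole group. *)
Lemma generates_weyl_group P :
  generates [set hat_refl a | a in [set a : Rx | P (val a)]] ->
  forall a, Rx a -> weyl_group form P (refl a).
Proof.
move=> genP a Ra H [[H1 HM HV] PH].
have act_rels (u w : word Rx) : hatW_rels u w ->
    word_act (fun a : Rx => refl (val a)) u =1
    word_act (fun a : Rx => refl (val a)) w.
  case=> [x|x y z zE] t /=; first exact: reflK.
  by rewrite zE refl_conj.
pose a' : Rx := SigSub (mem_set Ra).
rewrite -[refl a]/(refl (val a')) -(pres_act_gen (fun=> @reflK _) act_rels).
apply: (pres_act_generated (fun=> @reflK _) act_rels H1 HM HV genP).
move=> _ [b Pb <-].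
by rewrite pres_act_gen //; [apply: PH; exists (val b)|move=> ?; exact: reflK].
Qed.

(** For a stable [N], sending the generators of the roots in [N] to [1] and the
    others to [-1] respects the relations. This sign character, realised as an
    action on [bool], is trivial as soon as it is on a generating set. *)
Lemma generates_sub_stable P N :
  (forall a b, Rx a -> N b -> N (refl a b)) -> P `<=` N ->
  generates [set hat_refl a | a in [set a : Rx | P (val a)]] -> Rx `<=` N.
Proof.
move=> N_refl PN genP a Ra.
pose sgn (x : Rx) : bool -> bool := addb (~~ `[< N (val x) >]).
have sgnK x : involutive (sgn x) by exact: addKb.
have sgn_rels (u w : word Rx) : hatW_rels u w ->
    word_act sgn u =1 word_act sgn w.
  case=> [x|x y z zE] t /=; first exact: sgnK.
  have -> : sgn z = sgn y.
    rewrite /sgn zE; congr (addb (~~ _)); apply/asbool_equiv_eq; split.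
      by move=> /(N_refl _ _ (set_valP x)); rewrite reflK.
    exact: N_refl (set_valP x).
  by rewrite /sgn addbCA addKb.
have triv : forall g : hatW, [set id] (pres_act sgn g).
  apply: (@pres_act_generated _ _ _ _ sgnK sgn_rels _ [set id] _ _ _ genP).
  - by [].
  - by move=> u v -> ->.
  - by move=> u ->; exists id.
  move=> _ [b Pb <-]; rewrite pres_act_gen //; apply/funext => t.
  by rewrite /sgn asboolT //; exact: PN.
(* A sign is read off from where it moves [true]. *)
have := congr1 (@^~ true) (triv (hat_refl (SigSub (mem_set Ra) : Rx))).
by rewrite pres_act_gen // /sgn addbT negbK => /asboolP.
Qed.

(** [weyl_orbit form P] uses only the reflections in [P], but these generate
    every reflection in a root, so this orbit is a stable set containing [P]. *)
Lemma generates_weyl_orbit P : P `<=` Rx ->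
  generates [set hat_refl a | a in [set a : Rx | P (val a)]] ->
  weyl_orbit form P = Rx.
Proof.
move=> PR genP; apply/seteqP; split.
  apply: weyl_orbit_min => // a b Pa Rb.
  exact: refl_nonisotropic R_ears (PR _ Pa) Rb.
apply: (generates_sub_stable _ _ genP) => [a _ Ra [w Pw [b Pb <-]]|].
  exists (refl a \o w); last by exists b.
  exact: weyl_groupM (generates_weyl_group genP Ra) Pw.
exact: weyl_orbit_sub.
Qed.

End Reflections.

(** * The minimal generating set of a reflectable base *)

Theorem proposition5p2p1 (K : realType) (V : vectType K)
    (form : {symmetric V}) (R : set V)
    (form_psd : positive_semidefinite form)
    (R_ears : extended_affine_root_system form R)
    (R_reduced : reduced form R)
    (P : set V) (P_base : reflectable_base form R P) :
  minimal_generating_set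
    [set hat_refl a | a in [set a : nonisotropic form R | P (val a)]].
Proof.
have [PR orbP P_min] := P_base.
split=> [|B [BA /(_ _)AB] genB]; first exact: hat_refl_generates.
(* [B] is the image of a subset [P'] of [P], which is proper as [B] is. *)
pose P' := [set v | exists a : nonisotropic form R,
  [/\ val a = v, P (val a) & B (hat_refl a)]].
have PP' : P' `<=` P by move=> _ [a [<-]].
have BE :
    B = [set hat_refl a | a in [set a : nonisotropic form R | P' (val a)]].
  apply/seteqP; split=> [g Bg|_ [a [b [/val_inj <- _ Bb]] <-] //].
  by have [a Pa ga] := BA g Bg; exists a => //; exists a; rewrite ga.
apply: (P_min P').
  split=> // P_P'; apply: AB => _ [a Pa <-].
  by have [b [/val_inj <-]] := P_P' _ Pa.
apply: generates_weyl_orbit => //; first exact: subset_trans PP' PR.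
by rewrite -BE.
Qed.
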